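(* Let $\mathbb{K}$ be a field of characteristic zero, $n$ a positive integer and $t\geq n$ an integer. For any connected finite undirected loopless graph $G$ on $n$ vertices, the Tutte polynomial $T_G(x,y)$ is determined by the sequence of dimensions of the graded components of $\mathcal{B}^{F_t}_G$; i.e., if $G_1,G_2$ are connected graphs on $n$ vertices whose algebras $\mathcal{B}^{F_t}_{G_1},\mathcal{B}^{F_t}_{G_2}$ have the same Hilbert series, then $T_{G_1}=T_{G_2}$.
   Context: $\mathcal{B}^{F_t}_G=\mathbb{K}[x_1,\dots,x_n]/J$ (vertices $1,\dots,n$), where $J$ is generated by $\left(\sum_{i\in I}x_i\right)^{tD_I+1}$ for all nonempty $I\subseteq[n]$, $D_I$ being the number of edges of $G$ between $I$ and its complement; graded by degree. $T_G$ is the Tutte polynomial. *)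

(* Defs.v *)
From HB Require Import structures.
From mathcomp Require Import all_boot all_algebra.
From mathcomp Require Import ring_quotient.
From mathcomp Require Import boolp.
From mathcomp Require Import mpoly.

Set Implicit Arguments.
Unset Strict Implicit.
Unset Printing Implicit Defensive.

Import GRing.Theory.
Local Open Scope ring_scope.
Local Open Scope quotient_scope.

(* Finite undirected loopless graphs on the vertices 'I_n. Parallel edges are
   allowed: distinct edges may have the same (two-element) set of endpoints. *)
Record graph (n : nat) := Graph {
  edge :> finType;
  ends : edge -> {set 'I_n};
  card_ends : forall e, #|ends e| = 2%N
}.

Section GraphTheory.
Variables (n : nat) (G : graph n).
Implicit Types (A : {set edge G}) (I : {set 'I_n}).

Definition adj A : rel 'I_n :=
  [rel u v | [exists e in A, ends e == [set u; v]]].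

Definition connected : Prop := forall u v : 'I_n, connect (adj setT) u v.

Definition ncomp A : nat := n_comp (adj A) 'I_n.

Definition edge_rank A : nat := n - ncomp A.

(* The variables x and y are 'X_ord0 and 'X_ord_max; both natural-number
   subtractions in the exponents are exact. *)
Definition tutte : {mpoly int[2]} :=
  \sum_(A : {set edge G})
     ('X_ord0 - 1) ^+ (edge_rank setT - edge_rank A)
       * ('X_ord_max - 1) ^+ (#|A| - edge_rank A).

Definition cut I : {set edge G} :=
  [set e | (ends e :&: I != set0) && (ends e :&: ~: I != set0)].

Definition cut_size I : nat := #|cut I|.

End GraphTheory.

Section QuotientAlgebra.
Variables (K : fieldType) (A : comAlgType K) (J : idealr A).
Local Notation Q := {ideal_quot J}.

Definition quot_scale (a : K) (x : Q) : Q := \pi_Q (a *: repr x).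

Lemma eq_quot_pi (p q : A) : (p - q \in J) = (\pi_Q p == \pi_Q q).
Proof. exact: Quotient.idealrBE. Qed.

Lemma quot_scale_pi a (p : A) : quot_scale a (\pi_Q p) = \pi_Q (a *: p).
Proof.
apply/eqP; rewrite /quot_scale -eq_quot_pi -scalerBr -mulr_algl.
by apply: idealMr; rewrite eq_quot_pi reprK.
Qed.

Lemma quot_scaleA a b x :
  quot_scale a (quot_scale b x) = quot_scale (a * b) x.
Proof. by elim/quotW: x => p; rewrite (quot_scale_pi b p) !quot_scale_pi scalerA. Qed.

Lemma quot_scale1 : left_id 1 quot_scale.
Proof. by move=> x; rewrite /quot_scale scale1r reprK. Qed.

Lemma quot_scaleDr : right_distributive quot_scale +%R.
Proof.
move=> a; elim/quotW => p; elim/quotW => q; rewrite -rmorphD !quot_scale_pi.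
by rewrite scalerDr rmorphD.
Qed.

Lemma quot_scaleDl x : {morph quot_scale^~ x : a b / a + b}.
Proof. by move=> a b; elim/quotW: x => p; rewrite !quot_scale_pi scalerDl rmorphD. Qed.

HB.instance Definition _ := GRing.Zmodule_isLmodule.Build K Q
  quot_scaleA quot_scale1 quot_scaleDr quot_scaleDl.

Lemma quot_scaleAl (a : K) (x y : Q) : a *: (x * y) = (a *: x) * y.
Proof.
elim/quotW: x => p; elim/quotW: y => q; rewrite -rmorphM.
by rewrite /GRing.scale /= !quot_scale_pi -rmorphM scalerAl.
Qed.

HB.instance Definition _ := GRing.Lmodule_isLalgebra.Build K Q quot_scaleAl.

Lemma quot_piZ (a : K) (p : A) : \pi_Q (a *: p) = a *: \pi_Q p.
Proof. by rewrite -quot_scale_pi. Qed.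

End QuotientAlgebra.

Section Dimension.
Variables (K : fieldType) (V : lmodType K).
Implicit Types (S : V -> Prop) (r : nat).

Definition is_basis S r (b : 'I_r -> V) : Prop :=
  (forall i, S (b i)) /\
  (forall v, S v -> exists! c : {ffun 'I_r -> K}, v = \sum_i c i *: b i).

Definition has_dim S r : Prop := exists b : 'I_r -> V, is_basis S b.

Lemma has_dim_unique S r s : S 0 -> has_dim S r -> has_dim S s -> r = s.
Proof.
move=> S0; wlog lt_sr : r s / (s < r)%N => [W|].
  move=> Hr Hs; case: (ltngtP r s) => // h; first by symmetry; apply: W h Hs Hr.
  by apply: W h Hr Hs.
case=> b [bS bP] [c [cS cP]].
have [M MP] : exists M : 'M[K]_(r, s), forall i, b i = \sum_j M i j *: c j.
  have /choice [f fP] i := cP _ (bS i).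
  exists (\matrix_(i, j) f i j) => i; rewrite (fP i).1.
  by apply: eq_bigr => j _; rewrite mxE.
have : kermx M != 0.
  rewrite -mxrank_eq0 mxrank_ker subn_eq0 -ltnNge.
  exact: leq_ltn_trans (rank_leq_col M) lt_sr.
case/rowV0Pn => u /sub_kermxP uM0 /negP[]; apply/eqP/rowP => i; rewrite mxE.
have [c0 [_ c0P]] := bP _ S0.
have e1 : c0 = [ffun=> 0].
  by apply: c0P; rewrite big1 // => j _; rewrite ffunE scale0r.
have : c0 = [ffun j => u 0 j].
  apply: c0P; under eq_bigr => j _ do rewrite ffunE MP scaler_sumr.
  rewrite exchange_big big1 // => k _.
  under eq_bigr => j _ do rewrite scalerA.
  rewrite -scaler_suml.
  by move/rowP/(_ k): uM0; rewrite !mxE => ->; rewrite scale0r.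
by rewrite e1 => /ffunP/(_ i); rewrite !ffunE.
Qed.

Lemma has_dim_spanned S r (b : 'I_r -> V) :
    (forall i, S (b i)) ->
    (forall v, S v -> exists c : {ffun 'I_r -> K}, v = \sum_i c i *: b i) ->
  exists s, has_dim S s.
Proof.
pose sp r (b : 'I_r -> V) := (forall i, S (b i)) /\
  (forall v, S v -> exists c : {ffun 'I_r -> K}, v = \sum_i c i *: b i).
move=> bS bP.
have ex : exists r, `[< exists b : 'I_r -> V, sp r b >].
  by exists r; apply/asboolP; exists b.
case: (ex_minnP ex) => s /asboolP[d [dS dP]] smin {ex bS bP b r}.
exists s, d; split=> // v /dP[c vE]; exists c; split=> // c' vE'.
apply/ffunP => i; apply/eqP; apply: contraT => neq.
pose a j := c j - c' j.
have ai : a i != 0 by rewrite subr_eq0.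
have aE : \sum_j a j *: d j = 0.
  under eq_bigr => j _ do rewrite scalerBl.
  by rewrite sumrB -vE -vE' subrr.
case: s => [|s] in d dS dP smin c vE c' vE' i neq a ai aE *; first by case: i neq ai.
have di : d i = \sum_j (- (a i)^-1 * a (lift i j)) *: d (lift i j).
  have := aE; rewrite (bigD1_ord i) //= => /(congr1 ( *:%R (a i)^-1)).
  rewrite scaler0 scalerDr scalerA mulVf // scale1r => /eqP.
  rewrite addr_eq0 => /eqP ->; rewrite scaler_sumr -sumrN.
  by apply: eq_bigr => j _; rewrite scalerA mulNr scaleNr.
suff /smin : `[< exists b : 'I_s -> V, sp s b >] by rewrite ltnn.
apply/asboolP; exists (fun j => d (lift i j)); split=> [j|w /dP[f ->]].
  exact: dS.
exists [ffun j => f (lift i j) + f i * (- (a i)^-1 * a (lift i j))].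
rewrite (bigD1_ord i) //= di scaler_sumr -big_split /=.
apply: eq_bigr => j _; rewrite ffunE scalerDl addrC scalerA //.
Qed.

End Dimension.

Section Algebra.
Variables (K : fieldType) (t n : nat) (G : graph n).

Definition gen (I : {set 'I_n}) : {mpoly K[n]} :=
  (\sum_(i in I) 'X_i) ^+ (t * cut_size G I).+1.

Definition Jideal : {pred {mpoly K[n]}} := fun p =>
  `[< exists c : {set 'I_n} -> {mpoly K[n]},
        p = \sum_(I : {set 'I_n} | I != set0) c I * gen I >].

Lemma Jideal_idealr : idealr_closed Jideal.
Proof.
split.
- apply/asboolP; exists (fun=> 0).
  by rewrite big1 // => I _; rewrite mul0r.
- apply/asboolP => -[c /(congr1 (meval (fun=> 0)))].
  rewrite rmorph1 rmorph_sum big1 => [/eqP|I _]; first by rewrite oner_eq0.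
  rewrite rmorphM rmorphXn rmorph_sum big1 ?expr0n ?mulr0 // => i _.
  exact: mevalXU.
- move=> a _ _ /asboolP[c ->] /asboolP[d ->]; apply/asboolP.
  exists (fun I => a * c I + d I); rewrite mulr_sumr -big_split /=.
  by apply: eq_bigr => I _; rewrite mulrDl mulrA.
Qed.

HB.instance Definition _ := isIdealr.Build {mpoly K[n]} Jideal Jideal_idealr.

Definition algB : lalgType K := {ideal_quot Jideal}.

Definition piB (p : {mpoly K[n]}) : algB := \pi_{ideal_quot Jideal} p.

(* Jideal is generated by homogeneous polynomials, so algB is graded and its
   component of degree d is the image of the forms of degree d. *)
Definition graded (d : nat) (v : algB) : Prop :=
  exists2 p : {mpoly K[n]}, p \is d.-homog & v = piB p.

Lemma piB_linear : linear piB.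
Proof. move=> a p q; rewrite /piB rmorphD; congr (_ + _); exact: quot_piZ. Qed.

HB.instance Definition _ := GRing.isLinear.Build K _ _ _ piB piB_linear.

Lemma piB_eq0 p : (piB p == 0) = (p \in Jideal).
Proof.
rewrite -(linear0 piB) -[p in RHS]subr0.
by apply/esym; exact: (eq_quot_pi Jideal p 0).
Qed.

Lemma graded0 d : graded d 0.
Proof. by exists 0; rewrite ?rpred0 ?linear0. Qed.

Lemma graded_has_dim d : exists r, has_dim (graded d) r.
Proof.
pose T : finType := 'X_{1..n < d.+1}.
pose b (m : T) : {mpoly K[n]} := if mdeg m == d then 'X_[m] else 0.
apply: (has_dim_spanned (b := fun i => piB (b (enum_val i)))) => [i|v [p hp ->]].
  exists (b (enum_val i)) => //; rewrite /b.
  by case: ifP => h; rewrite ?dhomogX ?dhomog0.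
exists [ffun i => p@_(enum_val i : T)].
have sz : (msize p <= d.+1)%N.
  rewrite msizeE; apply/bigmax_leqP_seq => m mp _.
  by rewrite (dhomog_mf hp mp).
rewrite {1}[p](mpolywE sz) linear_sum /=.
under [RHS]eq_bigr => i _ do rewrite ffunE.
rewrite -(big_enum_val (fun m : T => p@_m *: piB (b m))) /=.
apply: eq_bigr => m _; rewrite -linearZ /b; case: eqP => [//|/eqP ne].
by rewrite (dhomog_nemf_coeff hp ne) !scale0r.
Qed.

Definition hilbert (d : nat) : nat := sval (cid (graded_has_dim d)).

Lemma hilbertP d : has_dim (graded d) (hilbert d).
Proof. exact: svalP (cid (graded_has_dim d)). Qed.

Lemma hilbert_unique d r : has_dim (graded d) r -> r = hilbert d.
Proof. by move=> h; exact: has_dim_unique (graded0 d) h (hilbertP d). Qed.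

End Algebra.

(* Main.v *)
Require Import Defs.
From HB Require Import structures.
From mathcomp Require Import all_boot all_algebra.
From mathcomp Require Import mpoly ring zify.
From mathcomp Require boolp.
Set Implicit Arguments.
Unset Strict Implicit.
Unset Printing Implicit Defensive.
Import GRing.Theory.
Local Open Scope ring_scope.

(** The component of degree d of the algebra is dual to the component of degree
    d of the inverse system of J: the forms f with (D_I)^(t cut(I) + 1) f = 0 for
    all I, where D_I is the sum of the partial derivatives over I.  Replacing
    every edge by t parallel copies reduces to t = 1.  Restriction to the
    hyperplane x_u = x_v maps the inverse system of a graph to the one of its
    contraction by the edge uv, and the kernel is x_u - x_v times the inverse
    system of the deletion; surjectivity holds because the inverse system is
    spanned by the products of the linear forms x_u - x_v over sets of edges.
    Deletion-contraction then gives, with kappa(A) components of ([n], A),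
      (1-q)^n Hilb(q)
        = sum_A q^(t(|E|-|A|)) (1-q^t)^|A| (1-q)^kappa(A).
    As 1 <= kappa(A) <= n <= t, the powers of 1-q that occur are independent over
    Z[q^t], so the Hilbert series determines the number of edge sets of given
    cardinality and number of components, hence the Tutte polynomial. *)

(** * Inverse systems of graphs *)

Section InverseSystem.
Variables (K : fieldType) (n : nat).
Implicit Types (p q f g h : {mpoly K[n]}) (c : 'I_n -> 'I_n) (I : {set 'I_n}).
Implicit Types (s : seq ('I_n * 'I_n)) (e : 'I_n * 'I_n) (d : nat).

Lemma mpoly_alg_ind (Q : {mpoly K[n]} -> Prop) :
    (forall a, Q a%:MP) -> (forall i, Q 'X_i) ->
    (forall p q, Q p -> Q q -> Q (p + q)) ->
    (forall p q, Q p -> Q q -> Q (p * q)) ->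
  forall p, Q p.
Proof.
move=> QC QX QD QM p; rewrite [p]mpolyE.
apply: big_ind => [|//|m _]; first by rewrite -mpolyC0.
rewrite -mul_mpolyC; apply: (QM) => //; rewrite mpolyXE_id.
apply: big_ind => [|//|i _]; first by rewrite -mpolyC1.
elim: (m i) => [|k IH]; first by rewrite expr0 -mpolyC1.
by rewrite exprS; apply: QM.
Qed.

(** * Derivatives along vertex sets *)

Definition dset I p : {mpoly K[n]} := \sum_(i in I) p^`M(i).

Lemma dset_is_linear I : linear (dset I).
Proof.
move=> a p q; rewrite /dset scaler_sumr -big_split /=.
by apply: eq_bigr => i _; rewrite mderivD mderivZ.
Qed.
HB.instance Definition _ I :=
  GRing.isLinear.Build K _ _ _ (dset I) (dset_is_linear I).

Lemma dsetC I a : dset I a%:MP = 0.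
Proof. by rewrite /dset big1 // => i _; rewrite mderivC. Qed.

Lemma dsetM I p q : dset I (p * q) = dset I p * q + p * dset I q.
Proof.
rewrite /dset mulr_suml mulr_sumr -big_split /=.
by apply: eq_bigr => i _; rewrite mderivM.
Qed.

Lemma mderivXU (i j : 'I_n) : ('X_i : {mpoly K[n]})^`M(j) = (i == j)%:R.
Proof.
rewrite mderivX mnm1E; case: eqP => [->|_]; last by rewrite scale0r.
by rewrite -{1}[U_(j)%MM]add0m addmK mpolyX0 scale1r.
Qed.

Lemma dsetXU I i : dset I ('X_i) = (i \in I)%:R.
Proof.
rewrite /dset; under eq_bigr => j _ do rewrite mderivXU.
have [iI|iI] := boolP (i \in I).
  by rewrite (bigD1 i) //= eqxx big1 ?addr0 // => j /andP[_ /negPf]; rewrite eq_sym => ->.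
by rewrite big1 // => j jI; case: eqP => // ij; rewrite ij jI in iI.
Qed.

Lemma dset_homog I d p : p \is d.+1.-homog -> dset I p \is d.-homog.
Proof.
move=> hp; apply: rpred_sum => i _; apply/dhomogP => m.
rewrite mcoeff_msupp mcoeff_deriv => nz; apply/eqP.
apply: contraNT nz => dm; rewrite (dhomog_nemf_coeff hp) ?mul0rn //=.
by rewrite mdegD mdeg1 addn1.
Qed.

Lemma homog0_const p : p \is 0.-homog -> p = (p@_0%MM)%:MP.
Proof.
move=> hp; apply/mpolyP => m; rewrite mcoeffC.
have [->|m0] := eqVneq; first by rewrite mulr1.
by rewrite mulr0 (dhomog_nemf_coeff hp) //= mdeg_eq0.
Qed.

Lemma dset_homog0 I p : p \is 0.-homog -> dset I p = 0.
Proof. by move/homog0_const ->; rewrite dsetC. Qed.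

Lemma iter_dset0 I k : iter k (dset I) 0 = 0.
Proof. by elim: k => //= k ->; rewrite linear0. Qed.

Lemma iter_dsetD I k p q :
  iter k (dset I) (p + q) = iter k (dset I) p + iter k (dset I) q.
Proof. by elim: k => //= k ->; rewrite linearD. Qed.

Lemma iter_dsetZ I k a p :
  iter k (dset I) (a *: p) = a *: iter k (dset I) p.
Proof. by elim: k => //= k ->; rewrite linearZ. Qed.

Lemma iter_dset_leq I k l p :
  (k <= l)%N -> iter k (dset I) p = 0 -> iter l (dset I) p = 0.
Proof. by move=> /subnK <- ; rewrite iterD => ->; apply: iter_dset0. Qed.

Lemma iter_dset_homog0 I d p : p \is d.-homog -> iter d.+1 (dset I) p = 0.
Proof.
elim: d p => [|d IH] p hp; first exact: dset_homog0.
by rewrite iterSr IH // dset_homog.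
Qed.

(** Since [dset I l] is constant, second derivatives of [l] vanish and the Leibniz expansion stops
    after two terms. *)
Lemma iter_dsetM I (a : K) l k g : dset I l = a%:MP ->
  iter k.+1 (dset I) (l * g)
    = l * iter k.+1 (dset I) g + (a *+ k.+1) *: iter k (dset I) g.
Proof.
move=> Dl; elim: k => [|k IH].
  by rewrite /= dsetM Dl mul_mpolyC addrC mulr1n.
rewrite iterS IH linearD linearZ /= dsetM Dl mul_mpolyC.
by rewrite addrAC -scalerDl -mulrS addrC.
Qed.

Hypothesis charK : [pchar K] =i pred0.

(* [l * dset I] is the Euler operator up to the factor [a], so
   its eigenvalues are nonnegative multiples of [a]. *)
Lemma euler_eq0 I (a : K) l N k h : a != 0 -> dset I l = a%:MP ->
    iter N (dset I) h = 0 ->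
    l * dset I h + (a *+ k.+1) *: h = 0 ->
  h = 0.
Proof.
move=> a0 Dl; have c0 := (pcharf0P K).1 charK.
elim: N k h => // N IH k h; rewrite iterSr => DN E.
have Dh : dset I h = 0.
  (* Differentiating [E] gives the same equation for [dset I h] with [k.+1] in place of [k], and
     [dset I h] dies one iteration earlier. *)
  apply: (IH k.+1) => //; have := congr1 (dset I) E.
  rewrite linear0 linearD linearZ /= dsetM Dl mul_mpolyC => <-.
  by rewrite addrAC -scalerDl -mulrS addrC.
move: E; rewrite Dh mulr0 add0r => /eqP.
by rewrite scaler_eq0 -mulr_natr mulf_eq0 (negPf a0) c0 => /eqP.
Qed.

(** * Identification of variables *)

Definition relabel c p : {mpoly K[n]} := p \mPo [tuple 'X_(c i) | i < n].

Lemma relabelXU c i : relabel c 'X_i = 'X_(c i).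
Proof. by rewrite /relabel comp_mpolyXU -tnth_nth tnth_mktuple. Qed.

HB.instance Definition _ c := GRing.RMorphism.copy (relabel c)
  (comp_mpoly [tuple ('X_(c i) : {mpoly K[n]}) | i < n]).
HB.instance Definition _ c := GRing.Linear.copy (relabel c)
  (comp_mpoly [tuple ('X_(c i) : {mpoly K[n]}) | i < n]).

Lemma relabelC c a : relabel c a%:MP = a%:MP.
Proof. exact: comp_mpolyC. Qed.

Lemma relabel_homog c d p : p \is d.-homog -> relabel c p \is d.-homog.
Proof.
move=> hp; rewrite /relabel comp_mpolyEX big_seq; apply: rpred_sum => m mp.
rewrite rpredZ //; rewrite comp_mpolyX.
under eq_bigr => i _ do rewrite tnth_mktuple mpolyXn.
rewrite -(big_morph _ (@mpolyXD _ _) (@mpolyX0 _ _)) dhomogX /= mdeg_sum.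
under eq_bigr => i _ do rewrite mdegMn mdeg1 mul1n.
by rewrite -mdegE; apply/eqP; apply: dhomog_mf mp.
Qed.

(** A chain rule: both sides are derivations along the ring morphism [relabel c], so it suffices to
    compare them on the variables. *)
Lemma dset_relabel c I p :
  dset I (relabel c p) = relabel c (dset [set i | c i \in I] p).
Proof.
elim/mpoly_alg_ind: p => [a|i|p q Hp Hq|p q Hp Hq].
- by rewrite relabelC !dsetC rmorph0.
- by rewrite relabelXU !dsetXU inE rmorph_nat.
- by rewrite rmorphD /= !linearD /= Hp Hq.
- by rewrite rmorphM !dsetM Hp Hq rmorphD !rmorphM.
Qed.

Lemma iter_dset_relabel c I k p :
  iter k (dset I) (relabel c p)
    = relabel c (iter k (dset [set i | c i \in I]) p).
Proof. by elim: k => //= k ->; rewrite dset_relabel. Qed.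

(* Contraction of an edge uv is modelled on the same vertex set: v is merged
   into u and stays behind as an isolated vertex. *)
Definition collapse (u v : 'I_n) : 'I_n -> 'I_n := fun x => if x == v then u else x.

Definition eform e : {mpoly K[n]} := 'X_(e.1) - 'X_(e.2).

Lemma eform_homog e : eform e \is 1.-homog.
Proof. by rewrite rpredB // dhomogX /= mdeg1. Qed.

Lemma dset_eform I e :
  dset I (eform e) = ((e.1 \in I)%:R - (e.2 \in I)%:R)%:MP.
Proof. by rewrite linearB /= !dsetXU rmorphB !rmorph_nat. Qed.

Lemma eform_neq0 e : e.1 != e.2 -> eform e != 0.
Proof.
move=> uv; rewrite subr_eq0; apply: contra uv => /eqP/(congr1 (mcoeff U_(e.1))).
rewrite !mcoeffXU eqxx; case: (eqVneq e.2 e.1) => [//|_ /eqP].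
by rewrite oner_eq0.
Qed.

Definition relabel_edge c e := (c e.1, c e.2).

Lemma relabel_eform c e : relabel c (eform e) = eform (relabel_edge c e).
Proof. by rewrite rmorphB /= !relabelXU. Qed.

Lemma relabel_collapse_eform u v : relabel (collapse u v) (eform (u, v)) = 0.
Proof. by rewrite relabel_eform /eform /= /collapse eqxx; case: eqP; rewrite subrr. Qed.

(** Collapsing [v] onto [u] is reduction modulo the linear form X_u - X_v; [g] is the quotient. *)
Lemma collapse_div u v p :
  exists g, p = relabel (collapse u v) p + eform (u, v) * g.
Proof.
elim/mpoly_alg_ind: p => [a|i|p q [gp Hp] [gq Hq]|p q [gp Hp] [gq Hq]].
- by exists 0; rewrite relabelC mulr0 addr0.
- rewrite relabelXU /collapse; case: eqP => [->|_].
    by exists (-1); rewrite mulrN1 /eform /= subKr.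
  by exists 0; rewrite mulr0 addr0.
- exists (gp + gq); rewrite {1}Hp {1}Hq rmorphD mulrDr /=.
  by rewrite addrACA.
- exists (relabel (collapse u v) p * gq + gp * q); rewrite rmorphM /=.
  by move: (relabel _ p) (relabel _ q) Hp Hq => a b -> ->; ring.
Qed.

Lemma pihomog_eformM e d g :
  pihomog mdeg d.+1 (eform e * g) = eform e * pihomog mdeg d g.
Proof.
rewrite [g]mpolyE mulr_sumr !linear_sum mulr_sumr /=; apply: eq_bigr => m _.
rewrite -scalerAr !linearZ /= -scalerAr; congr (_ *: _).
have hm : eform e * 'X_[m] \is (mdeg m).+1.-homog.
  by rewrite -[_.+1]add1n dhomogM ?eform_homog // dhomogX.
rewrite pihomogX; case: eqP => [<-|/eqP md]; first exact: pihomog_dE.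
by rewrite mulr0 (pihomog_ne0 _ hm).
Qed.

(** The quotient given by [collapse_div] comes without a degree, so its component of degree [d] is
    taken instead. *)
Lemma relabel_collapse_ker u v d f : f \is d.+1.-homog ->
    relabel (collapse u v) f = 0 ->
  exists2 g, g \is d.-homog & f = eform (u, v) * g.
Proof.
move=> hf f0; have [g] := collapse_div u v f; rewrite f0 add0r => fE.
exists (pihomog mdeg d g); first exact: pihomogP.
by rewrite -pihomog_eformM -fE pihomog_dE.
Qed.

(** Edges are a list of ordered pairs because contraction can create loops, which [graph] excludes.
    A loop is never cut, and reversing a pair only changes the sign of its [eform]. *)
Definition cutn s I := count (fun e => (e.1 \in I) != (e.2 \in I)) s.

Definition inv_sys s d f : Prop :=
  f \is d.-homog /\ forall I, iter (cutn s I).+1 (dset I) f = 0.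

(* The span of the products of [eform] over the d-element subsequences of s. *)
Fixpoint zono s d f : Prop :=
  if s is e :: s' then
    exists g h, [/\ zono s' d g, if d is d'.+1 then zono s' d' h else h = 0
                  & f = g + eform e * h]
  else if d is 0 then f \is 0.-homog else f = 0.

Lemma inv_sys0 s d : inv_sys s d 0.
Proof. by split=> [|I]; rewrite ?rpred0 ?iter_dset0. Qed.

Lemma inv_sysD s d f g : inv_sys s d f -> inv_sys s d g -> inv_sys s d (f + g).
Proof.
move=> [hf Hf] [hg Hg]; split=> [|I]; first exact: rpredD.
by rewrite iter_dsetD Hf Hg addr0.
Qed.

Lemma inv_sysZ s d a f : inv_sys s d f -> inv_sys s d (a *: f).
Proof.
move=> [hf Hf]; split=> [|I]; first exact: rpredZ.
by rewrite iter_dsetZ Hf scaler0.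
Qed.

Lemma inv_sys_loop s d e f : e.1 = e.2 -> inv_sys (e :: s) d f <-> inv_sys s d f.
Proof.
move=> ee; have E I : cutn (e :: s) I = cutn s I by rewrite /cutn /= ee eqxx.
by split=> -[hf Hf]; split=> // I; move: (Hf I); rewrite E.
Qed.

Lemma inv_sys_const s f : f \is 0.-homog -> inv_sys s 0 f.
Proof. by move=> hf; split=> // I; rewrite iterSr dset_homog0 // iter_dset0. Qed.

Lemma zono0 s d : zono s d 0.
Proof.
elim: s d => [|e s IH] [|d] //=; first exact: rpred0.
  by exists 0, 0; split; rewrite ?mulr0 ?addr0.
by exists 0, 0; split; rewrite ?mulr0 ?addr0.
Qed.

Lemma zono_cons s d e f : zono s d f -> zono (e :: s) d f.
Proof.
by exists f, 0; split; rewrite ?mulr0 ?addr0 //; case: d {H} => // d; exact: zono0.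
Qed.

Lemma inv_sys_cons s d e f : inv_sys s d f -> inv_sys (e :: s) d f.
Proof.
by move=> [hf Hf]; split=> // I; apply: iter_dset_leq (Hf I); rewrite ltnS leq_addl.
Qed.

(** If [e] crosses [I], the allowed order of vanishing grows by one and both Leibniz terms vanish;
    otherwise [eform e] is a constant for [dset I]. *)
Lemma inv_sys_eform s d e f : inv_sys s d f -> inv_sys (e :: s) d.+1 (eform e * f).
Proof.
move=> [hf Hf]; split=> [|I]; first by rewrite -add1n dhomogM ?eform_homog.
rewrite (iter_dsetM _ _ (dset_eform I e)) /cutn /= -/(cutn s I).
case: eqP => [->|_] /=.
  by rewrite subrr mul0rn scale0r addr0 -iterS Hf mulr0.
by rewrite add1n -iterS Hf scaler0 linear0 mulr0 addr0.
Qed.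

Lemma zono_inv_sys s d f : zono s d f -> inv_sys s d f.
Proof.
elim: s d f => [|e s IH] d f /=.
  by case: d => [|d] => [/inv_sys_const|->]; last exact: inv_sys0.
case=> g [h [/IH Hg Hh ->]]; apply: inv_sysD; first exact: inv_sys_cons.
case: d Hh {Hg} => [->|d /IH]; first by rewrite mulr0; exact: inv_sys0.
exact: inv_sys_eform.
Qed.

Lemma inv_sys_relabel c s d f :
  inv_sys s d f -> inv_sys (map (relabel_edge c) s) d (relabel c f).
Proof.
move=> [hf Hf]; split=> [|I]; first exact: relabel_homog.
rewrite iter_dset_relabel.
suff -> : cutn (map (relabel_edge c) s) I = cutn s [set i | c i \in I].
  by rewrite Hf rmorph0.
by rewrite /cutn count_map; apply: eq_count => e /=; rewrite !inE.
Qed.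

(** This is where spanning by products pays off: a product of relabelled forms lifts factor by
    factor, whereas the differential conditions of [inv_sys] offer no evident lift. *)
Lemma zono_relabel_lift c s d f : zono (map (relabel_edge c) s) d f ->
  exists2 g, zono s d g & relabel c g = f.
Proof.
elim: s d f => [|e s IH] d f /=.
  case: d => [hf|d ->]; last by exists 0; rewrite ?rmorph0.
  by exists f => //; rewrite (homog0_const hf) relabelC.
case=> g [h [/IH[g' Hg' <-] Hh ->]].
have [h' Hh' <-] : exists2 h', (if d is d'.+1 then zono s d' h' else h' = 0)
    & relabel c h' = h.
  by case: d Hh {Hg'} => [->|d /IH //]; exists 0; rewrite ?rmorph0.
exists (g' + eform e * h'); first by exists g', h'.
by rewrite rmorphD rmorphM /= relabel_eform.
Qed.

(** Converse to [inv_sys_eform]. If [e] does not cross [I], cancel [eform e]; if it does, the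
    Leibniz formula is an Euler equation that only 0 solves. *)
Lemma inv_sys_divl s d e g : e.1 != e.2 -> g \is d.-homog ->
  inv_sys (e :: s) d.+1 (eform e * g) -> inv_sys s d g.
Proof.
move=> uv hg [_ Hg]; split=> // I; have := Hg I.
rewrite (iter_dsetM _ _ (dset_eform I e)) /cutn /= -/(cutn s I).
case: eqP => [->|/eqP cut].
  rewrite subrr mul0rn scale0r addr0 => /eqP.
  by rewrite mulf_eq0 (negPf (eform_neq0 uv)) => /eqP.
(* Here [euler_eq0] is applied to the iterate of order [(cutn s I).+1] of [g], with constant 1 or
   -1; nilpotency comes from the degree of [g]. *)
rewrite add1n iterS => E; apply: (euler_eq0 (N := d.+1) _ (dset_eform I e) _ E).
  by case: (e.1 \in I) (e.2 \in I) cut => [] [];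
     rewrite ?subr0 ?sub0r ?oppr_eq0 ?oner_eq0.
by rewrite -iterSr iterS -iterD addnC iterD (iter_dset_homog0 I hg) iter_dset0 linear0.
Qed.

Lemma inv_sys_nil d f : inv_sys [::] d f -> zono [::] d f.
Proof.
case: d => [|d] [hf Hf] //=; apply/mpolyP => m; rewrite mcoeff0.
have [md|md] := eqVneq (mdeg m) d.+1; last exact: dhomog_nemf_coeff hf md.
have /existsP[i mi] : [exists i, 0 < m i]%N.
  apply: contraT; rewrite negb_exists => /forallP m0.
  by move: md; rewrite mdegE big1 // => i _; apply/eqP; rewrite -leqn0 leqNgt.
(* Without edges all cuts are empty, so each partial derivative of [f] vanishes; this coefficient is
   [m i] times that of [m] in [f]. *)
have := congr1 (mcoeff (m - U_(i))) (Hf [set i]).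
rewrite /= /dset big_set1 mcoeff_deriv mcoeff0 submK; last first.
  by apply/mnm_lepP => j; rewrite mnm1E; case: eqP => // <-.
move/eqP; rewrite -mulr_natr mulf_eq0 (pcharf0P K).1 //.
by rewrite orbF => /eqP.
Qed.

(** Contract the first edge: the image of [f] is spanned by products, which lift to some [g] in
    [zono s d]. Then [f - g] is in the kernel, hence [eform] times an element of the inverse system
    of the deletion. Both uses of induction concern shorter lists, but not always tails, hence
    induction on the size. *)
Lemma inv_sys_zono s d f : inv_sys s d f -> zono s d f.
Proof.
have [k] := ubnP (size s); elim: k s d f => // k IH [|e s] d f.
  by move=> _; exact: inv_sys_nil.
rewrite ltnS => sk Hf; have [ee|ne] := eqVneq e.1 e.2.
  by apply: zono_cons; apply: IH => //; apply/(inv_sys_loop _ _ _ ee).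
case: d Hf => [|d] Hf.
  by apply: zono_cons; apply: IH => //; apply: inv_sys_const; case: Hf.
case: e sk ne Hf => u v sk ne Hf; pose c := collapse u v.
have [ec] : (relabel_edge c (u, v)).1 = (relabel_edge c (u, v)).2.
  by rewrite /= /c /collapse eqxx; case: eqP.
have := inv_sys_relabel c Hf; rewrite /= => /(inv_sys_loop _ _ _ ec).
move/IH; rewrite size_map => /(_ sk) /zono_relabel_lift[g Hg gf].
have Hg' := inv_sys_cons (u, v) (zono_inv_sys Hg).
have Hfg : inv_sys ((u, v) :: s) d.+1 (f - g).
  by rewrite -scaleN1r; apply: inv_sysD Hf (inv_sysZ _ Hg').
have [|h hh fE] := relabel_collapse_ker (u := u) (v := v) Hfg.1.
  by rewrite rmorphB /= gf subrr.
exists g, h; split=> //; last by rewrite -fE addrC subrK.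
by apply: IH => //; apply: inv_sys_divl ne hh _; rewrite -fE.
Qed.

End InverseSystem.

(** * Deletion and contraction for dimensions *)

Lemma has_dim_ext (K : fieldType) (V : lmodType K) (S S' : V -> Prop) r :
  (forall v, S v <-> S' v) -> has_dim S r -> has_dim S' r.
Proof.
move=> SS' [b [bS bP]]; exists b; split=> [i|v /SS' Sv]; last exact: bP.
exact/SS'.
Qed.

(** Dimension is additive on short exact sequences: the images of a basis of [A] and lifts of a
    basis of [C] form a basis of [B]. *)
Lemma has_dim_exact (K : fieldType) (U V W : lmodType K)
    (A : U -> Prop) (B : V -> Prop) (C : W -> Prop)
    (f : {linear U -> V}) (g : {linear V -> W}) r s :
    (forall a u v, B u -> B v -> B (a *: u + v)) ->
    (forall u, A u -> B (f u)) -> injective f ->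
    (forall u, A u -> g (f u) = 0) ->
    (forall v, B v -> g v = 0 -> exists2 u, A u & f u = v) ->
    (forall v, B v -> C (g v)) ->
    (forall w, C w -> exists2 v, B v & g v = w) ->
  has_dim A r -> has_dim C s -> has_dim B (r + s).
Proof.
move=> Blin fAB finj gf0 gker gBC glift [a [aA aP]] [c [cC cP]].
have /boolp.choice[l lP] j : exists v, B v /\ g v = c j.
  by have [v Bv gv] := glift _ (cC j); exists v.
pose b (k : 'I_(r + s)) := match split k with inl i => f (a i) | inr j => l j end.
have bl i : b (lshift s i) = f (a i).
  by rewrite /b -[lshift s i]/(unsplit (inl i)) unsplitK.
have br j : b (rshift r j) = l j.
  by rewrite /b -[rshift r j]/(unsplit (inr j)) unsplitK.
have bE (x : {ffun 'I_(r + s) -> K}) : \sum_k x k *: b k =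
    f (\sum_i x (lshift s i) *: a i) + \sum_j x (rshift r j) *: l j.
  rewrite big_split_ord linear_sum; congr (_ + _); apply: eq_bigr => i _.
    by rewrite bl linearZ.
  by rewrite br.
have gl (x : 'I_s -> K) : g (\sum_j x j *: l j) = \sum_j x j *: c j.
  by rewrite linear_sum; apply: eq_bigr => j _; rewrite linearZ (lP j).2.
have gfa (x : 'I_r -> K) : g (f (\sum_i x i *: a i)) = 0.
  rewrite !linear_sum big1 // => i _.
by rewrite !linearZ /= (gf0 _ (aA i)) scaler0.
exists b; split=> [k|v Bv].
  by rewrite /b; case: (split k) => [i|j]; [apply: fAB | apply: (lP j).1].
have [y [yE yU]] := cP _ (gBC _ Bv).
(* [B] is only known to be closed under [a *: u + v], so the lifted part of [v] is subtracted one
   term at a time. *)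
have Bsum (J : seq 'I_s) : B (v - \sum_(j <- J) y j *: l j).
  elim: J => [|j J IH]; first by rewrite big_nil subr0.
  have -> : v - \sum_(i <- j :: J) y i *: l i = - y j *: l j + (v - \sum_(i <- J) y i *: l i).
    by rewrite big_cons scaleNr opprD addrCA.
  by apply: Blin => //; apply: (lP j).1.
have [|u Au fu] := gker _ (Bsum (index_enum 'I_s)).
  by rewrite linearB /= gl yE subrr.
have [x [xE xU]] := aP _ Au.
exists [ffun k => match split k with inl i => x i | inr j => y j end].
split=> [|z zE].
  rewrite bE.
  under eq_bigr => i _ do
    rewrite ffunE -[lshift s i]/(unsplit (inl i)) unsplitK.
  under [X in _ + X]eq_bigr => j _ do
    rewrite ffunE -[rshift r j]/(unsplit (inr j)) unsplitK.
  by rewrite -xE fu subrK.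
rewrite bE in zE.
have zy : y = [ffun j => z (rshift r j)].
  apply: yU; under eq_bigr => j _ do rewrite ffunE.
  by rewrite zE linearD /= gfa add0r gl.
have zx : x = [ffun i => z (lshift s i)].
  apply: xU; under eq_bigr => i _ do rewrite ffunE.
  apply: finj; rewrite fu zE zy.
  by under [X in _ - X]eq_bigr => j _ do rewrite ffunE; rewrite addrK.
apply/ffunP => k; rewrite ffunE zx zy.
by case: (splitP k) => i ki; rewrite ffunE; congr (z _); apply: val_inj.
Qed.

(** * Hilbert series of inverse systems *)

Section HilbertPoly.
Variables (K : fieldType) (n : nat).
Hypothesis charK : [pchar K] =i pred0.
Implicit Types (s : seq ('I_n * 'I_n)) (e : 'I_n * 'I_n) (H : {poly int}).

Definition has_hilb s H :=
  forall d, exists2 r, has_dim (@inv_sys K n s d) r & H`_d = r%:Z.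

Lemma has_hilb_nil : has_hilb [::] 1.
Proof.
case=> [|d].
  exists 1%N; last by rewrite coef1.
  exists (fun=> 1); split=> [_|v [hv _]].
    by apply: inv_sys_const; apply: dhomog1.
  exists [ffun=> v@_0%MM]; split=> [|x ->].
    by rewrite big_ord1 ffunE {1}(homog0_const hv) -mul_mpolyC mulr1.
  apply/ffunP => i; rewrite ffunE big_ord1 mcoeffZ mcoeff1 eqxx mulr1.
  by rewrite (ord1 i).
exists 0%N; last by rewrite coef1.
exists (fun=> 0); split=> [[]//|v /(inv_sys_nil charK)/= ->].
exists [ffun=> 0]; split=> [|x _]; first by rewrite big_ord0.
by apply/ffunP => -[].
Qed.

Lemma has_hilb_loop s e H : e.1 = e.2 -> has_hilb s H -> has_hilb (e :: s) H.
Proof.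
move=> ee Hs d; have [r hr Hr] := Hs d; exists r => //.
by apply: has_dim_ext hr => v; rewrite inv_sys_loop.
Qed.

Definition eform_mul e (f : {mpoly K[n]}) := eform K e * f.

Lemma eform_mul_is_linear e : linear (eform_mul e).
Proof. by move=> a f g; rewrite /eform_mul mulrDr scalerAr. Qed.
HB.instance Definition _ e :=
  GRing.isLinear.Build K _ _ _ (eform_mul e) (eform_mul_is_linear e).

(** Multiplication by [eform] followed by [relabel] is an exact sequence from the deletion in degree
    [d] to the contraction in degree [d.+1]. Degree 0 is separate: there both systems consist of the
    constants. *)
Lemma has_hilb_delcon s (u v : 'I_n) H H' : u != v -> has_hilb s H ->
    has_hilb (map (relabel_edge (collapse u v)) s) H' ->
  has_hilb ((u, v) :: s) ('X * H + H').
Proof.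
move=> uv Hs Hc [|d].
  have [r hr Hr] := Hc 0%N; exists r; last by rewrite coefD coefXM Hr add0r.
  by apply: has_dim_ext hr => f; split=> -[hf _]; apply: inv_sys_const.
have [r hr Hr] := Hs d; have [r' hr' Hr'] := Hc d.+1.
exists (r + r')%N; last by rewrite coefD coefXM Hr Hr' PoszD.
have c_loop : (relabel_edge (collapse u v) (u, v)).1 = (relabel_edge (collapse u v) (u, v)).2.
  by rewrite /= /collapse eqxx; case: eqP.
apply: (has_dim_exact (f := eform_mul (u, v)) (g := relabel (collapse u v)) _ _ _ _ _ _ _ hr hr').
- by move=> a f g Hf Hg; apply: inv_sysD Hg; apply: inv_sysZ.
- by move=> f; apply: inv_sys_eform.
- by apply: mulfI; apply: eform_neq0.
- by move=> f _; rewrite /= /eform_mul rmorphM /= relabel_collapse_eform mul0r.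
- move=> f Hf /(relabel_collapse_ker Hf.1)[g hg fE]; exists g => //.
  by apply: (inv_sys_divl charK (e := (u, v)) uv hg); rewrite -fE.
- by move=> f /(inv_sys_relabel (collapse u v)) /= /(inv_sys_loop _ _ _ c_loop).
- move=> f /(inv_sys_zono charK)/zono_relabel_lift[g Hg gf]; exists g => //.
  by apply: inv_sys_cons; apply: zono_inv_sys.
Qed.

Lemma has_hilb_loops s e k H :
  e.1 = e.2 -> has_hilb s H -> has_hilb (nseq k e ++ s) H.
Proof. by move=> ee Hs; elim: k => //= k; apply: has_hilb_loop. Qed.

(** Contracting one copy turns the other copies into loops, so every contraction contributes the
    same [H'], with a geometric sum as total weight. *)
Lemma has_hilb_copies s (u v : 'I_n) k H H' : u != v -> has_hilb s H ->
    has_hilb (map (relabel_edge (collapse u v)) s) H' ->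
  has_hilb (nseq k (u, v) ++ s) ('X^k * H + (\sum_(i < k) 'X^i) * H').
Proof.
move=> uv Hs Hc; elim: k => [|k IH]; first by rewrite big_ord0 mul1r mul0r addr0.
have -> : 'X^(k.+1) * H + (\sum_(i < k.+1) 'X^i) * H' =
    'X * ('X^k * H + (\sum_(i < k) 'X^i) * H') + H' :> {poly int}.
  rewrite big_ord_recl expr0 exprS.
  under eq_bigr => i _ do rewrite exprS.
  by rewrite -mulr_sumr; ring.
apply: has_hilb_delcon => //; rewrite map_cat map_nseq.
apply: has_hilb_loops => //=.
by rewrite /collapse eqxx; case: eqP.
Qed.

End HilbertPoly.

(** * Connected components *)

Section Components.
Variables (n : nat) (G : graph n).
Implicit Types (A B : {set edge G}) (e : edge G) (c : 'I_n -> 'I_n).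

Lemma ends_pair e : exists uv, [&& uv.1 != uv.2 & ends e == [set uv.1; uv.2]].
Proof.
have /cards2P[u [v [uv eE]]] := introT eqP (card_ends e).
by exists (u, v); rewrite uv eE eqxx.
Qed.

Definition edge_pair e : 'I_n * 'I_n := xchoose (ends_pair e).

Lemma edge_pair_neq e : (edge_pair e).1 != (edge_pair e).2.
Proof. by have /andP[] := xchooseP (ends_pair e). Qed.

Lemma ends_edge_pair e : ends e = [set (edge_pair e).1; (edge_pair e).2].
Proof. by have /andP[_ /eqP] := xchooseP (ends_pair e). Qed.

(** Such a [c] presents the contraction of all edges of [A]: vertices get one label exactly when [A]
    connects them. *)
Definition labels A c := forall x y, connect (adj A) x y = (c x == c y).

Lemma adj_sym A x y : adj A x y = adj A y x.
Proof. by rewrite /adj /= setUC. Qed.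

Lemma connect_adj_sym A : connect_sym (adj A).
Proof. by apply: sym_connect_sym => x y; apply: adj_sym. Qed.

Lemma ncomp_labels A c : labels A c -> ncomp A = #|[set c x | x in 'I_n]|.
Proof.
move=> Ac; rewrite /ncomp /n_comp_mem.
have -> : [set c x | x in 'I_n] = [set c x | x in roots (adj A)].
  apply/setP => y; apply/imsetP/imsetP => -[x _ ->]; last by exists x.
  exists (fingraph.root (adj A) x); first exact: (roots_root (connect_adj_sym A)).
  by apply/eqP; rewrite -Ac connect_root.
rewrite card_in_imset => [|x y]; first by apply: eq_card => x; rewrite !inE andbT.
rewrite !inE => /eqP rx /eqP ry /eqP; rewrite -Ac -rx -ry.
rewrite -(root_connect (connect_adj_sym A)) => /eqP; rewrite !root_root //.
all: exact: connect_adj_sym.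
Qed.

Lemma labels0 : labels set0 id.
Proof.
move=> x y; apply/idP/eqP => [/connectP[[|z p] //=]|->]; last exact: connect0.
by case/andP => /existsP[e]; rewrite inE.
Qed.

Lemma adj_edge A e : e \in A -> adj A (edge_pair e).1 (edge_pair e).2.
Proof. by move=> eA; apply/existsP; exists e; rewrite eA ends_edge_pair eqxx. Qed.

Lemma sub_connect_adj A B : A \subset B ->
  subrel (connect (adj A)) (connect (adj B)).
Proof.
move=> AB; apply: connect_sub => x y /existsP[e /andP[eA eE]].
by apply: connect1; apply/existsP; exists e; rewrite eE (subsetP AB).
Qed.

Lemma labels_add A c e : labels A c ->
  labels (e |: A) (collapse (c (edge_pair e).1) (c (edge_pair e).2) \o c).
Proof.
set u := (edge_pair e).1; set v := (edge_pair e).2 => Ac x y /=.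
have AA : subrel (connect (adj A)) (connect (adj (e |: A))).
  by apply: sub_connect_adj; apply: subsetUr.
have uv : connect (adj (e |: A)) u v by apply/connect1/adj_edge/setU11.
have uv' : connect (adj (e |: A)) v u by rewrite connect_adj_sym.
have lift a b : c a = c b -> connect (adj (e |: A)) a b.
  by move=> ab; apply: AA; rewrite Ac ab.
apply/idP/eqP => [|].
  case/connectP => p; elim: p x => [|z p IH] x /=; first by move=> _ ->.
  case/andP => /existsP[f /andP[]]; rewrite in_setU1 => /predU1P[->|fA] fE.
    move=> /IH {}IH /IH <-; move: fE; rewrite ends_edge_pair -/u -/v => /eqP E.
    have /set2P xuv : x \in [set u; v] by rewrite E set21.
    have /set2P zuv : z \in [set u; v] by rewrite E set22.
    by rewrite /collapse; case: xuv zuv => -> [] ->; rewrite ?eqxx ?if_same.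
  move=> /IH {}IH /IH <-; congr (collapse _ _ _); apply/eqP; rewrite -Ac.
  by apply/connect1/existsP; exists f; rewrite fA.
rewrite /collapse; case: eqP => [xv|_]; case: eqP => [yv|_] E.
- by apply: lift; rewrite xv yv.
- apply: connect_trans (lift _ _ xv) (connect_trans uv' (lift _ _ E)).
- apply: connect_trans (lift _ _ E) (connect_trans uv (lift _ _ (esym yv))).
- exact: lift.
Qed.

Lemma ncomp_add A c e : labels A c ->
    c (edge_pair e).1 != c (edge_pair e).2 ->
  ncomp A = (ncomp (e |: A)).+1.
Proof.
set u := (edge_pair e).1; set v := (edge_pair e).2 => Ac uv.
rewrite (ncomp_labels Ac) (ncomp_labels (labels_add e Ac)) -/u -/v.
rewrite (cardsD1 (c v)) imset_f // add1n; congr _.+1; apply: eq_card => y.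
rewrite !inE; apply/andP/imsetP => [[yv /imsetP[x _ yE]]|[x _ ->]].
  by exists x; rewrite //= /collapse -yE (negPf yv).
rewrite /= /collapse; case: ifP => [_|/negbT xv]; last by rewrite xv imset_f.
by rewrite uv imset_f.
Qed.

Lemma ncomp_add_id A c e : labels A c ->
    c (edge_pair e).1 = c (edge_pair e).2 ->
  labels (e |: A) c /\ ncomp (e |: A) = ncomp A.
Proof.
move=> Ac uv; have := labels_add e Ac; rewrite uv => H.
have Ac' : labels (e |: A) c.
  have cid a z : @collapse n a a z = z by rewrite /collapse; case: eqP.
  by move=> x y; rewrite H /= !cid.
by rewrite (ncomp_labels Ac') (ncomp_labels Ac).
Qed.

Lemma ncomp0 : ncomp (set0 : {set edge G}) = n.
Proof. by rewrite (ncomp_labels labels0) card_imset // card_ord. Qed.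

Lemma labels_exists A : exists c, labels A c.
Proof.
exists (fingraph.root (adj A)) => x y.
by rewrite (root_connect (connect_adj_sym A)).
Qed.

(** Makes the empty set the only one with [n] components, from which the number of edges is later
    read off. *)
Lemma ncomp_ltn A : A != set0 -> (ncomp A < n)%N.
Proof.
case/set0Pn => e eA; have [c Ac] := labels_exists A.
rewrite (ncomp_labels Ac) -[X in (_ < X)%N]card_ord ltn_neqAle leq_imset_card andbT.
apply/negP => /imset_injP cinj; have := edge_pair_neq e; case/eqP; apply: cinj => //.
by apply/eqP; rewrite -Ac connect1 // adj_edge.
Qed.

Lemma ncomp_leq A : (ncomp A <= n)%N.
Proof.
have [->|/ncomp_ltn/ltnW//] := eqVneq A set0; by rewrite ncomp0.
Qed.

Lemma ncomp_gt0 A : (0 < n)%N -> (0 < ncomp A)%N.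
Proof.
move=> n0; have [c Ac] := labels_exists A; rewrite (ncomp_labels Ac) card_gt0.
by apply/set0Pn; exists (c (Ordinal n0)); rewrite imset_f.
Qed.

Lemma ncomp_connected : (0 < n)%N -> connected G -> ncomp (setT : {set edge G}) = 1%N.
Proof.
move=> n0 conG; rewrite (@ncomp_labels _ (fun=> Ordinal n0)).
  apply/eqP/cards1P; exists (Ordinal n0); apply/setP => y; rewrite inE.
  by apply/imsetP/eqP => [[]//|->]; exists (Ordinal n0).
by move=> x y; rewrite conG eqxx.
Qed.

End Components.

(** * Expansion of the Hilbert series over edge sets *)

Section Expansion.
Variables (K : fieldType) (charK : [pchar K] =i pred0).
Variables (n : nat) (G : graph n) (t : nat).
Implicit Types (A B : {set edge G}) (e : edge G) (c : 'I_n -> 'I_n).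
Implicit Types (l : seq (edge G)).

Definition copies c l : seq ('I_n * 'I_n) :=
  flatten [seq nseq t (relabel_edge c (edge_pair e)) | e <- l].

Lemma map_copies c c' l :
  map (relabel_edge c') (copies c l) = copies (c' \o c) l.
Proof.
rewrite /copies map_flatten -map_comp; congr flatten.
by apply: eq_map => e /=; rewrite map_nseq.
Qed.

(** [B] holds the edges contracted so far; each remaining edge is deleted with weight ['X^t] or
    contracted with weight [1 - 'X^t]. *)
Fixpoint expansion B l : {poly int} :=
  if l is e :: l' then
    'X^t * expansion B l' + (1 - 'X^t) * expansion (e |: B) l'
  else (1 - 'X) ^+ ncomp B.

(** An edge that has become a loop gives two equal branches, whose weights add up to 1. For any
    other edge, contraction lowers [ncomp] by one, and the freed factor [1 - 'X] turns the geometric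
    sum into [1 - 'X^t]. *)
Lemma has_hilb_expansion B c l : labels B c ->
  exists2 H, has_hilb K (copies c l) H & (1 - 'X) ^+ ncomp B * H = expansion B l.
Proof.
elim: l B c => [|e l IH] B c Bc /=.
  by exists 1; [apply: has_hilb_nil | rewrite mulr1].
rewrite /copies /= -/(copies c l).
have [uv|uv] := eqVneq (c (edge_pair e).1) (c (edge_pair e).2).
  have [Bc' ncE] := ncomp_add_id Bc uv.
  have [H hH HE] := IH _ _ Bc'; have [H' hH' HE'] := IH _ _ Bc.
  have HH : H = H'.
    apply/polyP => d; have [r hr ->] := hH d; have [r' hr' ->] := hH' d.
    by congr Posz; apply: has_dim_unique hr hr'; apply: inv_sys0.
  exists H; first exact: has_hilb_loops.
  by rewrite -HE -HE' ncE HH; ring.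
have Bc' := labels_add e Bc.
have [H hH HE] := IH _ _ Bc; have [H' hH' HE'] := IH _ _ Bc'.
exists ('X^t * H + (\sum_(i < t) 'X^i) * H').
  by apply: has_hilb_copies => //; rewrite map_copies.
rewrite -HE -HE' (ncomp_add Bc uv) exprS.
have -> : 1 - 'X^t = (1 - 'X) * (\sum_(i < t) 'X^i) :> {poly int}.
  by rewrite -opprB subrX1 -mulNr opprB.
ring.
Qed.

(** The two branches at [e] are the sets [A] without [e] and those with [e], the latter reindexed by
    removing [e]. *)
Lemma expansionE B l : uniq l ->
  expansion B l = \sum_(A : {set edge G} | A \subset [set e in l])
    'X^(t * (size l - #|A|)) * (1 - 'X^t) ^+ #|A| * (1 - 'X) ^+ ncomp (A :|: B).
Proof.
elim: l B => [|e l IH] B /=.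
  rewrite (big_pred1 set0) => [|A].
    by rewrite cards0 muln0 !mul1r set0U.
  by rewrite /= -subset0; congr (_ \subset _); apply/setP => e; rewrite !inE.
case/andP => el ul; rewrite !IH // [RHS](bigID (fun A => e \in A)) /= [RHS]addrC.
congr (_ + _); rewrite mulr_sumr.
  apply: eq_big => [A|A Al].
    apply/idP/andP => [Al|[/subsetP Al eA]].
      split; last by apply: contra el => /(subsetP Al); rewrite inE.
      by apply: subset_trans Al _; apply/subsetP => x; rewrite !inE => ->; rewrite orbT.
    apply/subsetP => x xA; have := Al _ xA; rewrite !inE.
    by case/predU1P => // xe; rewrite xe (negPf eA) in xA.
  have cA : (#|A| <= size l)%N.
    by rewrite (leq_trans (subset_leq_card Al)) // cardsE card_size.
  by rewrite subSn // mulnS exprD !mulrA.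
rewrite [RHS](reindex_onto (fun A => e |: A) (fun A => A :\ e)) /=; last first.
  by move=> A /andP[_ eA]; rewrite setD1K.
apply: eq_big => [A|A Al].
  apply/idP/idP => [Al|].
    have eA : e \notin A by apply: contra el => /(subsetP Al); rewrite inE.
    rewrite setU11 setU1K // eqxx !andbT.
    apply/subsetP => x; rewrite !inE => /predU1P[->|/(subsetP Al)]; rewrite ?eqxx //.
    by rewrite inE => ->; rewrite orbT.
  case/andP => /andP[/subsetP Al _] /eqP eA; apply/subsetP => x xA.
  have xe : x != e by move: xA; rewrite -eA !inE; case/andP.
  by have := Al x; rewrite !inE xA orbT (negPf xe) => /(_ isT).
have eA : e \notin A by apply: contra el => /(subsetP Al); rewrite inE.
rewrite cardsU1 eA add1n subSS exprS setUCA setUA; ring.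
Qed.

Lemma hilbert_series_expansion :
  exists2 H, has_hilb K (copies id (enum (edge G))) H &
    (1 - 'X) ^+ n * H = \sum_(A : {set edge G})
      'X^(t * (#|edge G| - #|A|)) * (1 - 'X^t) ^+ #|A| * (1 - 'X) ^+ ncomp A.
Proof.
have [H hH HE] := has_hilb_expansion (enum (edge G)) (labels0 G).
exists H => //; rewrite -{1}(ncomp0 G) HE expansionE ?enum_uniq // -cardE.
apply: eq_big => [A|A _]; last by rewrite setU0.
by apply/subsetP => x _; rewrite inE mem_enum.
Qed.

Lemma cutn_copies I : cutn (copies id (enum (edge G))) I = (t * cut_size G I)%N.
Proof.
rewrite /cutn /copies count_flatten -map_comp /cut_size cardE size_filter.
rewrite -sum1_count big_distrr /= sumnE big_map big_mkcond /=.
rewrite [RHS]big_mkcond /= ?enumT; apply: eq_bigr => e _.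
rewrite count_nseq /= inE ends_edge_pair; set u := _.1; set v := _.2.
have meets S : ([set u; v] :&: S != set0) = (u \in S) || (v \in S).
  apply/set0Pn/orP => [[x]|[h|h]].
  - by rewrite inE => /andP[/set2P[->|->] ->]; [left|right].
  - by exists u; rewrite inE h set21.
  - by exists v; rewrite inE h set22.
by rewrite !meets !inE; case: (u \in I); case: (v \in I); rewrite /= ?mul1n ?mul0n ?muln1.
Qed.

End Expansion.

(** * Duality *)

Section Apolarity.
Variables (K : fieldType) (n : nat).
Implicit Types (p f g : {mpoly K[n]}) (m : 'X_{1..n}) (I : {set 'I_n}).

Definition mfact m : nat := \prod_(i < n) (m i)`!.

Lemma mfactU m i : mfact (U_(i) + m)%MM = ((m i).+1 * mfact m)%N.
Proof.
rewrite /mfact (bigD1 i) //= [in RHS](bigD1 i) //= mnmDE mnm1E eqxx add1n factS.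
rewrite mulnA; congr (_ * _)%N; apply: eq_bigr => j ji.
by rewrite mnmDE mnm1E eq_sym (negPf ji).
Qed.

(* The pairing (p, f) |-> (p(d/dx) f)(0). *)
Definition apolar f p : K := \sum_(m <- msupp f) p@_m * f@_m * (mfact m)%:R.

Lemma apolar_is_scalar f : scalar (apolar f).
Proof.
move=> a p q; rewrite /apolar mulr_sumr -big_split /=.
by apply: eq_bigr => m _; rewrite mcoeffD mcoeffZ; ring.
Qed.
HB.instance Definition _ f :=
  GRing.isLinear.Build K _ _ _ (apolar f) (apolar_is_scalar f).

Lemma apolarX f m : apolar f 'X_[m] = f@_m * (mfact m)%:R.
Proof.
rewrite /apolar; have [mf|mf] := boolP (m \in msupp f).
  rewrite (bigD1_seq m) ?msupp_uniq //= mcoeffX eqxx mul1r big1 ?addr0 // => m' ne.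
  by rewrite mcoeffX eq_sym (negPf ne) !mul0r.
rewrite (memN_msupp_eq0 mf) mul0r big_seq big1 // => m' m'f.
rewrite mcoeffX; case: eqP => [mm'|]; last by rewrite !mul0r.
by rewrite mm' m'f in mf.
Qed.

(** The pairing is symmetric, so the support of either argument may index the sum. *)
Lemma apolarE f p : apolar f p = \sum_(m <- msupp p) p@_m * f@_m * (mfact m)%:R.
Proof.
rewrite {1}[p]mpolyE linear_sum; apply: eq_bigr => m _.
by rewrite linearZ /= apolarX mulrA.
Qed.

(** Multiplication by a variable is adjoint to the derivative: the extra factor in the factorial is
    the exponent brought down. *)
Lemma apolar_mderiv f p i : apolar f ('X_i * p) = apolar f^`M(i) p.
Proof.
rewrite [p]mpolyE mulr_sumr !linear_sum; apply: eq_bigr => m _.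
rewrite -scalerAr !linearZ /= -mpolyXD !apolarX mfactU mcoeff_deriv addmC.
by rewrite natrM -[f@__ *+ _]mulr_natr !mulrA.
Qed.

Lemma apolar_suml (T : Type) (r : seq T) (P : pred T) (a : T -> K)
    (F : T -> {mpoly K[n]}) p :
  apolar (\sum_(i <- r | P i) a i *: F i) p = \sum_(i <- r | P i) a i * apolar (F i) p.
Proof.
under [RHS]eq_bigr => i _ do rewrite apolarE mulr_sumr.
rewrite exchange_big apolarE; apply: eq_bigr => m _.
rewrite raddf_sum mulr_sumr mulr_suml; apply: eq_bigr => i _.
by rewrite /= mcoeffZ; ring.
Qed.

Lemma apolar_dset f p I : apolar f ((\sum_(i in I) 'X_i) * p) = apolar (dset I f) p.
Proof.
rewrite mulr_suml linear_sum /dset /=.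
under eq_bigr => i _ do rewrite apolar_mderiv.
under [X in apolar X _]eq_bigr => i _ do rewrite -[mderiv i f]scale1r.
by rewrite apolar_suml; apply: eq_bigr => i _; rewrite mul1r.
Qed.

Lemma apolar_iter_dset f p I k :
  apolar f ((\sum_(i in I) 'X_i) ^+ k * p) = apolar (iter k (dset I) f) p.
Proof.
elim: k f => [|k IH] f; first by rewrite mul1r.
by rewrite exprS -mulrA apolar_dset IH -iterSr.
Qed.

Lemma apolar_neq_homog f p d d' : d != d' ->
  f \is d.-homog -> p \is d'.-homog -> apolar f p = 0.
Proof.
move=> dd' hf hp; rewrite apolarE big_seq big1 // => m mp.
rewrite (dhomog_nemf_coeff hf) ?mulr0 ?mul0r //=.
by have /= -> := dhomog_mf hp mp; rewrite eq_sym.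
Qed.

End Apolarity.

Section Duality.
Variables (K : fieldType) (charK : [pchar K] =i pred0).
Variables (t n : nat) (G : graph n) (s : seq ('I_n * 'I_n)).
Hypothesis cut_s : forall I, cutn s I = (t * cut_size G I)%N.

Lemma mfact_neq0 (m : 'X_{1..n}) : (mfact m)%:R != 0 :> K.
Proof.
rewrite (pcharf0P K).1 // -lt0n prodn_gt0 // => i; exact: fact_gt0.
Qed.

Lemma gen_homog I : gen K t G I \is (cutn s I).+1.-homog.
Proof.
rewrite cut_s -[X in X.-homog]mul1n dhomogMn //; apply: rpred_sum => i _.
by rewrite dhomogX /= mdeg1.
Qed.

Lemma Jideal_apolar d (f p : {mpoly K[n]}) :
  inv_sys s d f -> p \in Jideal t G -> apolar f p = 0.
Proof.
move=> [_ Hf] /boolp.asboolP[c ->]; rewrite linear_sum big1 // => I _.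
by rewrite /= mulrC /gen apolar_iter_dset -cut_s Hf /apolar msupp0 big_nil.
Qed.

Lemma gen_Jideal I (p : {mpoly K[n]}) : I != set0 -> gen K t G I * p \in Jideal t G.
Proof.
move=> I0; apply/boolp.asboolP; exists (fun I' => if I' == I then p else 0).
rewrite (bigD1 I) //= eqxx big1 ?addr0 ?[_ * p]mulrC // => I' /andP[_ /negPf ->].
by rewrite mul0r.
Qed.

(** The coefficient of [m] in an iterated derivative of [f] is, up to [mfact m], the pairing of [f]
    with [gen] times ['X_[m]], a member of the ideal. The empty [I], which gives no generator, has
    [dset I = 0]. *)
Lemma inv_sys_of_Jideal d (f : {mpoly K[n]}) : f \is d.-homog ->
    (forall p, p \is d.-homog -> p \in Jideal t G -> apolar f p = 0) ->
  inv_sys s d f.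
Proof.
move=> hf Hf; split=> // I; have [->|I0] := eqVneq I set0.
  by rewrite iterSr /dset big_set0 iter_dset0.
apply/mpolyP => m; apply: (mulIf (mfact_neq0 m)).
rewrite -apolarX -apolar_iter_dset mcoeff0 mul0r cut_s -/(gen K t G I).
have hp : gen K t G I * 'X_[m] \is ((cutn s I).+1 + mdeg m).-homog.
  by rewrite dhomogM ?gen_homog // dhomogX.
have [dE|ne] := eqVneq d ((cutn s I).+1 + mdeg m)%N.
  by apply: Hf; [rewrite dE | apply: gen_Jideal].
exact: apolar_neq_homog ne hf hp.
Qed.

(** The dual basis is built: [F i] represents, through the pairing, the [i]-th coordinate on the
    graded component. *)
Lemma has_dim_inv_sys d r :
  has_dim (@graded K t n G d) r -> has_dim (@inv_sys K n s d) r.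
Proof.
case=> b [bS bP].
have /boolp.choice[q qP] i : exists p, p \is d.-homog /\ b i = piB t G p.
  by have [p hp pE] := bS i; exists p.
have /boolp.choice[x xP] (m : 'X_{1..n}) : exists c : {ffun 'I_r -> K},
    mdeg m = d -> piB t G 'X_[m] = \sum_i c i *: b i.
  have [md|md] := eqVneq (mdeg m) d; last by exists [ffun=> 0] => /eqP; rewrite (negPf md).
  have [|c [cE _]] := bP (piB t G 'X_[m]); last by exists c.
  by exists 'X_[m] => //; rewrite dhomogX /= md.
(* Dividing by [mfact m] makes the pairing of [F i] with ['X_[m]] equal to [x m i]. *)
pose F i : {mpoly K[n]} := \sum_(m : 'X_{1..n < d.+1} | mdeg m == d)
  (x m i / (mfact m)%:R) *: 'X_[m].
have hF i : F i \is d.-homog.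
  by apply: rpred_sum => m md; rewrite rpredZ // dhomogX.
have FX m i : mdeg m = d -> apolar (F i) 'X_[m] = x m i.
  move=> md; have lt_m : (mdeg m < d.+1)%N by rewrite md.
  rewrite apolarX /F raddf_sum (bigD1 (BMultinom lt_m)) /= ?md //.
  rewrite mcoeffZ mcoeffX eqxx mulr1 big1 ?addr0 ?divfK ?mfact_neq0 //.
  move=> m' /andP[_ ne]; rewrite mcoeffZ mcoeffX; case: eqP => [mm'|]; last by rewrite mulr0.
  by case/eqP: ne; apply: val_inj.
have piE p : p \is d.-homog -> piB t G p = \sum_i apolar (F i) p *: b i.
  move=> hp; rewrite {1}[p]mpolyE linear_sum /=.
  transitivity (\sum_(m <- msupp p) \sum_i (p@_m * x m i) *: b i).
    rewrite big_seq [RHS]big_seq; apply: eq_bigr => m mp.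
    rewrite linearZ /= (xP _ (dhomog_mf hp mp)) scaler_sumr.
    by apply: eq_bigr => i _; rewrite scalerA.
  rewrite exchange_big; apply: eq_bigr => i _; rewrite -scaler_suml; congr (_ *: _).
  rewrite [in RHS](mpolyE p) linear_sum big_seq [RHS]big_seq; apply: eq_bigr => m mp.
  by rewrite linearZ /= FX // (dhomog_mf hp mp).
have coordU (c c' : 'I_r -> K) : \sum_i c i *: b i = \sum_i c' i *: b i -> c =1 c'.
  move=> cc'; have [|z [_ zU]] := bP (\sum_i c i *: b i).
    exists (\sum_i c i *: q i); last first.
      by rewrite linear_sum; apply: eq_bigr => i _; rewrite linearZ /= -(qP i).2.
    by apply: rpred_sum => i _; rewrite rpredZ // (qP i).1.
  have z1 : z = [ffun i => c i].
    by apply: zU; apply: eq_bigr => i _; rewrite ffunE.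
  have z2 : z = [ffun i => c' i].
    by apply: zU; rewrite cc'; apply: eq_bigr => i _; rewrite ffunE.
  by move=> i; move: z1; rewrite z2 => /ffunP/(_ i); rewrite !ffunE.
have Fq i j : apolar (F i) (q j) = (i == j)%:R.
  apply: (coordU (fun i => apolar (F i) (q j)) (fun i => (i == j)%:R)).
  rewrite -piE ?(qP j).1 // -(qP j).2 (bigD1 j) //= eqxx scale1r big1 ?addr0 // => k ne.
  by rewrite (negPf ne) scale0r.
exists F; split=> [i|f Hf].
  apply: inv_sys_of_Jideal => // p hp; rewrite -piB_eq0 piE // => /eqP p0.
  apply: (coordU (fun i => apolar (F i) p) (fun=> 0)).
  by rewrite p0 big1 // => j _; rewrite scale0r.
exists [ffun i => apolar f (q i)]; split=> [|c fE].
  under eq_bigr => i _ do rewrite ffunE.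
  apply/mpolyP => m; have [md|md] := eqVneq (mdeg m) d; last first.
    rewrite (dhomog_nemf_coeff Hf.1) // (@dhomog_nemf_coeff _ _ mdeg d) //.
    by apply: rpred_sum => i _; rewrite rpredZ.
  apply: (mulIf (mfact_neq0 m)); rewrite -!apolarX apolar_suml.
  (* The monomial minus the lift of its expansion in the basis lies in the ideal, so [f] annihilates
     it. *)
  pose p := 'X_[m] - \sum_i apolar (F i) 'X_[m] *: q i.
  have : apolar f p = 0.
    apply: Jideal_apolar Hf _; rewrite -piB_eq0 linearB linear_sum /=.
    rewrite piE ?dhomogX /= ?md // subr_eq0; apply/eqP; apply: eq_bigr => i _.
    by rewrite linearZ /= -(qP i).2.
  rewrite linearB linear_sum /= => /eqP; rewrite subr_eq0 => /eqP ->.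
  by apply: eq_bigr => i _; rewrite linearZ mulrC.
apply/ffunP => j; rewrite ffunE fE apolar_suml (bigD1 j) //= Fq eqxx mulr1.
by rewrite big1 ?addr0 // => i ne; rewrite Fq (negPf ne) mulr0.
Qed.

End Duality.

(** * Recovering the Tutte polynomial *)

(** Substituting [1 - 'X] for ['X] turns the powers of [1 - 'X] into those of ['X]. *)
Lemma expr_1subX_free (n : nat) (c : nat -> int) :
  \sum_(j < n) c j *: (1 - 'X) ^+ j = 0 :> {poly int} ->
  forall j, (j < n)%N -> c j = 0.
Proof.
move=> /(congr1 (comp_poly (1 - 'X))); rewrite linear0 linear_sum /= => E j lt_j.
have := congr1 (fun p : {poly int} => p`_j) E; rewrite coef0 coef_sum => <-.
under eq_bigr => i _ do
  rewrite linearZ /= rmorphXn rmorphB rmorph1 /= comp_polyX subKr coefZ coefXn.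
rewrite (bigD1 (Ordinal lt_j)) //= eqxx mulr1 big1 ?addr0 // => i ne.
by rewrite eq_sym -[_ == _]/(i == Ordinal lt_j) (negPf ne) mulr0.
Qed.

Lemma size_1subX_exp (j : nat) : size ((1 - 'X : {poly int}) ^+ j) = j.+1.
Proof.
rewrite -opprB exprNn -signr_odd.
by case: odd; rewrite ?expr0 ?expr1 ?mulN1r ?mul1r ?size_polyN size_exp_XsubC.
Qed.

(* The reason is that 1, X, ..., X^(t-1) is a basis of Z[X] over Z[X^t]. *)
Lemma expr_1subX_free_over_Xt (n t : nat) (C : nat -> {poly int}) :
    (n <= t)%N ->
    \sum_(j < n) (C j \Po 'X^t) * (1 - 'X) ^+ j = 0 ->
  forall j, (j < n)%N -> C j = 0.
Proof.
move=> nt; have [L] : exists L, forall j, (j < n)%N -> (size (C j) <= L)%N.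
  exists (\max_(j < n) size (C j)) => j lt_j.
  exact: (leq_bigmax (Ordinal lt_j)).
elim: L C => [|L IH] C szC E j lt_j.
  by apply/eqP; rewrite -size_poly_leq0 szC.
pose c j := (C j)`_0; pose D j := drop_poly 1 (C j).
have CE i : C i = (c i)%:P + D i * 'X.
  rewrite -{1}(poly_take_drop 1 (C i)) expr1; congr (_ + _).
  by rewrite [LHS]size1_polyC ?size_take_poly // coef_take_poly.
(* Splitting off constant terms, [Q] has degree below [n <= t] while [S * 'X^t] starts in degree
   [t], so both vanish; [S] is handled by induction on the size bound. *)
pose Q := \sum_(i < n) c i *: (1 - 'X) ^+ i : {poly int}.
pose S := \sum_(i < n) (D i \Po 'X^t) * (1 - 'X) ^+ i.
have QS : Q + S * 'X^t = 0.
  rewrite -E /Q /S mulr_suml -big_split /=; apply: eq_bigr => i _.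
  by rewrite CE rmorphD rmorphM /= comp_polyC comp_polyX -mul_polyC; ring.
have Q0 : Q = 0.
  apply/polyP => i; rewrite coef0; have [it|ti] := ltnP i t.
    have := congr1 (fun p : {poly int} => p`_i) QS.
    by rewrite coefD coefMXn it addr0 coef0.
  apply: nth_default; apply: leq_trans (size_sum _ _ _) _.
  apply/bigmax_leqP => k _; apply: leq_trans (size_scale_leq _ _) _.
  by rewrite size_1subX_exp (leq_trans (ltn_ord k)) // (leq_trans nt).
have S0 : S = 0.
  move/eqP: QS; rewrite Q0 add0r mulf_eq0 expf_eq0 polyX_eq0 andbF orbF.
  by move/eqP.
rewrite CE (expr_1subX_free Q0) // (IH D) ?mul0r ?addr0 // => k lt_k.
by rewrite size_drop_poly leq_subLR add1n szC.
Qed.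

(** Evaluation at 0 isolates the last coefficient; the remaining sum is divisible by ['X], which
    lowers [m]. *)
Lemma bernstein_free (m : nat) (c : nat -> int) :
    \sum_(a < m.+1) c a *: ('X^(m - a) * (1 - 'X) ^+ a) = 0 :> {poly int} ->
  forall a, (a <= m)%N -> c a = 0.
Proof.
have cm k : \sum_(a < k.+1) c a *: ('X^(k - a) * (1 - 'X) ^+ a) = 0 :> {poly int} ->
    c k = 0.
  move/(congr1 (horner^~ 0)); rewrite horner0 horner_sum big_ord_recr /=.
  rewrite subnn expr0 mul1r !hornerE expr1n mulr1 big1 ?add0r // => a _.
  by rewrite !hornerE expr0n subn_eq0 leqNgt ltn_ord /= !(mul0r, mulr0).
elim: m => [|m IH] E a le_a.
  by have -> : a = 0%N by [lia]; apply: cm.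
have cm1 := cm _ E; move: le_a; rewrite leq_eqVlt => /predU1P[->//|lt_a].
apply: IH lt_a; move: E; rewrite big_ord_recr /= cm1 scale0r addr0.
have -> : \sum_(i < m.+1) c i *: ('X^(m.+1 - i) * (1 - 'X) ^+ i) =
    'X * \sum_(i < m.+1) c i *: ('X^(m - i) * (1 - 'X) ^+ i) :> {poly int}.
  rewrite mulr_sumr; apply: eq_bigr => i _.
  by rewrite subSn ?exprS -1?ltnS // -scalerAr mulrA.
by move/eqP; rewrite mulf_eq0 polyX_eq0 => /eqP.
Qed.

(** * Counting edge sets by size and number of components *)

Section Statistics.
Variables (n : nat) (G : graph n).
Implicit Types (A : {set edge G}) (a k : nat).
Local Notation m := #|edge G|.

Definition nsets a k := #|[set A : {set edge G} | (ncomp A == k) && (#|A| == a)]|.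

(** The coefficient of (1-q)^k in the expansion of the Hilbert series, with ['X] standing for
    q^t. *)
Definition component_poly k : {poly int} :=
  \sum_(A : {set edge G} | ncomp A == k) 'X^(m - #|A|) * (1 - 'X) ^+ #|A|.

Lemma sum_by_ncomp (V : nmodType) (F : {set edge G} -> V) :
  \sum_A F A = \sum_(k < n.+1) \sum_(A | ncomp A == k) F A.
Proof.
rewrite (partition_big (fun A => inord (ncomp A) : 'I_n.+1) predT) //=.
apply: eq_bigr => k _; apply: eq_bigl => A.
by rewrite -val_eqE /= inordK // ltnS ncomp_leq.
Qed.

Lemma sum_by_card (V : nmodType) (F : nat -> V) k :
  \sum_(A : {set edge G} | ncomp A == k) F #|A| = \sum_(a < m.+1) F a *+ nsets a k.
Proof.
rewrite (partition_big (fun A : {set edge G} => inord #|A| : 'I_m.+1) predT) //=.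
apply: eq_bigr => a _; rewrite /nsets -sumr_const.
apply: eq_big => A; last first.
  by case/andP => _ /eqP <-; rewrite inordK // ltnS max_card.
by rewrite inE -val_eqE /= inordK // ltnS max_card.
Qed.

Lemma component_poly0 : (0 < n)%N -> component_poly 0 = 0.
Proof.
move=> n0; rewrite /component_poly big_pred0 // => A.
by rewrite eqn0Ngt ncomp_gt0.
Qed.

Lemma component_poly_max : component_poly n = 'X^m.
Proof.
rewrite /component_poly (big_pred1 set0) => [|A /=].
  by rewrite cards0 subn0 mulr1.
apply/eqP/eqP => [AE|->]; last exact: ncomp0.
by have [->|/ncomp_ltn] := eqVneq A set0; rewrite ?AE ?ltnn.
Qed.

Lemma component_poly_nsets k :
  component_poly k = \sum_(a < m.+1) (nsets a k)%:Z *: ('X^(m - a) * (1 - 'X) ^+ a).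
Proof.
rewrite /component_poly (sum_by_card (fun a => 'X^(m - a) * (1 - 'X) ^+ a)).
by apply: eq_bigr => a _; rewrite -scaler_nat natz.
Qed.

(** No edge set has 0 components, so a factor [1 - 'X] comes out; the exponents left are below [n],
    as [expr_1subX_free_over_Xt] requires. *)
Lemma expansion_component_poly t : (0 < n)%N ->
  \sum_(A : {set edge G})
      'X^(t * (m - #|A|)) * (1 - 'X^t) ^+ #|A| * (1 - 'X) ^+ ncomp A =
  (1 - 'X) * \sum_(k < n) (component_poly k.+1 \Po 'X^t) * (1 - 'X) ^+ k.
Proof.
move=> n0; rewrite sum_by_ncomp big_ord_recl [X in X + _]big_pred0 => [|A]; last first.
  by rewrite eqn0Ngt ncomp_gt0.
rewrite add0r mulr_sumr; apply: eq_bigr => k _.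
rewrite rmorph_sum mulr_suml mulr_sumr; apply: eq_bigr => A /eqP ->.
rewrite rmorphM !rmorphXn /= rmorphB /= rmorph1 comp_polyX -exprM exprS.
by ring.
Qed.

Lemma tutte_nsets : (0 < n)%N -> connected G ->
  tutte G = \sum_(k < n.+1) \sum_(a < m.+1)
    (('X_ord0 - 1) ^+ (n - 1 - (n - k)) * ('X_ord_max - 1) ^+ (a - (n - k)))
      *+ nsets a k.
Proof.
move=> n0 conG; rewrite /tutte sum_by_ncomp; apply: eq_bigr => k _.
rewrite -(sum_by_card (fun a =>
  ('X_ord0 - 1) ^+ (n - 1 - (n - k)) * ('X_ord_max - 1) ^+ (a - (n - k)))).
by apply: eq_bigr => A /eqP kA; rewrite /edge_rank ncomp_connected // kA.
Qed.

End Statistics.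

Lemma hilbert_has_hilb (K : fieldType) (charK : [pchar K] =i pred0) (n t : nat)
    (G : graph n) (H : {poly int}) :
  has_hilb K (copies t id (enum (edge G))) H ->
  forall d, H`_d = (hilbert K t G d)%:Z.
Proof.
move=> hH d; have [r hr ->] := hH d; congr Posz.
apply: has_dim_unique hr _; first exact: inv_sys0.
apply: has_dim_inv_sys => //; first exact: cutn_copies.
exact: hilbertP.
Qed.

Theorem mainTheorem5 (K : fieldType) (charK : [pchar K] =i pred0)
    (n t : nat) (n_gt0 : (0 < n)%N) (le_nt : (n <= t)%N)
    (G1 G2 : graph n) (conG1 : connected G1) (conG2 : connected G2)
    (eqH : forall d : nat, hilbert K t G1 d = hilbert K t G2 d) :
  tutte G1 = tutte G2.
Proof.
have [H1 hH1 E1] := hilbert_series_expansion charK G1 t.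
have [H2 hH2 E2] := hilbert_series_expansion charK G2 t.
have H12 : H1 = H2.
  apply/polyP => d.
  by rewrite (hilbert_has_hilb charK hH1) (hilbert_has_hilb charK hH2) eqH.
have X1 : 1 - 'X != 0 :> {poly int}.
  by rewrite -size_poly_eq0 -[_ - _]expr1 size_1subX_exp.
have /(mulfI X1) /eqP :
    (1 - 'X) * \sum_(k < n) (component_poly G1 k.+1 \Po 'X^t) * (1 - 'X) ^+ k =
    (1 - 'X) * \sum_(k < n) (component_poly G2 k.+1 \Po 'X^t) * (1 - 'X) ^+ k.
  by rewrite -!expansion_component_poly // -E1 -E2 H12.
rewrite -subr_eq0 -sumrB => /eqP E.
have compE k : (0 < k <= n)%N -> component_poly G1 k = component_poly G2 k.
  case: k => // k /= lt_k; apply/eqP; rewrite -subr_eq0; apply/eqP.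
  apply: (expr_1subX_free_over_Xt le_nt _ lt_k
    (C := fun j => component_poly G1 j.+1 - component_poly G2 j.+1)).
  by rewrite -[RHS]E; apply: eq_bigr => j _; rewrite rmorphB mulrBl.
(* The edge counts must agree before the remaining polynomials are compared, as they fix the
   Bernstein degree; [k = n] gives them. *)
have m12 : #|edge G1| = #|edge G2|.
  have := compE n; rewrite n_gt0 leqnn !component_poly_max => /(_ isT).
  by move/(congr1 (fun p : {poly int} => size p)); rewrite !size_polyXn => -[].
rewrite !tutte_nsets // -m12; apply: eq_bigr => -[k lt_k] _.
apply: eq_bigr => -[a lt_a] _ /=.
congr (_ *+ _); have : component_poly G1 k = component_poly G2 k.
  by case: k lt_k => [|k] lt_k; [rewrite !component_poly0 | apply: compE].
move/eqP; rewrite !component_poly_nsets -m12 -subr_eq0 -sumrB => /eqP F.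
apply/eqP; rewrite -eqz_nat -subr_eq0; apply/eqP.
apply: (bernstein_free (m := #|edge G1|)
  (c := fun a => (nsets G1 a k)%:Z - (nsets G2 a k)%:Z) _ lt_a).
by rewrite -[RHS]F; apply: eq_bigr => j _; rewrite scalerBl.
Qed.
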